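(* $$(B_4(\mathbb{D}^2))^{(2)}/(B_4(\mathbb{D}^2))^{(3)}\cong\mathbb{Z}_2\times\mathbb{Z}_2\times\left(\Gamma_2(\mathbb{F}_2(u,v))\right)^{\mathrm{Ab}},$$ where $\mathbb{F}_2(u,v)$ is the free group of rank $2$ on $u,v$.
   Context: $\mathbb{D}^2$ is the closed $2$-disc and $B_4(\mathbb{D}^2)$ is Artin's $4$-string braid group, generated by $\sigma_1,\sigma_2,\sigma_3$ subject to $\sigma_1\sigma_3=\sigma_3\sigma_1$ and $\sigma_i\sigma_{i+1}\sigma_i=\sigma_{i+1}\sigma_i\sigma_{i+1}$ for $i=1,2$. Derived series: $G^{(0)}=G$, $G^{(i)}=[G^{(i-1)},G^{(i-1)}]$. $\Gamma_2(G)=[G,G]$ and $G^{\mathrm{Ab}}=G/\Gamma_2(G)$. $\mathbb{Z}_2$ is the cyclic group of order $2$. *)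

(* Defs.v *)
From HB Require Import structures.
From mathcomp Require Import all_boot generic_quotient zmodp.
From mathcomp Require Import boolp classical_sets.

Set Implicit Arguments.
Unset Strict Implicit.
Unset Printing Implicit Defensive.

Local Open Scope classical_set_scope.
Local Open Scope quotient_scope.
Local Open Scope group_scope.

Definition is_subgroup (G : groupType) (H : set G) : Prop :=
  H 1 /\ forall x y, H x -> H y -> H (x / y).

Record subgroup (G : groupType) := Subgroup {
  sg_set :> G -> Prop;
  sgP : is_subgroup sg_set }.

Section SubgroupTheory.
Variables (G : groupType) (H : subgroup G).

Lemma sg1 : H 1. Proof. by case: (sgP H). Qed.

Lemma sgF x y : H x -> H y -> H (x / y).
Proof. by case: (sgP H) => _; apply. Qed.

Lemma sgV x : H x -> H x^-1.
Proof. by move=> Hx; rewrite -div1g; apply: sgF => //; apply: sg1. Qed.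

Lemma sgM x y : H x -> H y -> H (x * y).
Proof. by move=> Hx Hy; rewrite -(invgK y); apply: sgF => //; apply: sgV. Qed.

Definition subg_type : Type := {x : G | x \in (sg_set H : set G)}.

HB.instance Definition _ := SubType.on subg_type.
HB.instance Definition _ := Choice.on subg_type.

Fact subg_group_closed : group_closed (mem (sg_set H : set G)).
Proof.
split; first by apply: mem_set; apply: sg1.
by move=> x y /set_mem Hx /set_mem Hy; apply: mem_set; apply: sgF.
Qed.

HB.instance Definition _ :=
  SubChoice_isSubGroup.Build G (mem (sg_set H : set G)) subg_type subg_group_closed.

End SubgroupTheory.

Fact setT_is_subgroup (G : groupType) : is_subgroup (@setT G).
Proof. by []. Qed.

Definition setT_sg (G : groupType) : subgroup G := Subgroup (@setT_is_subgroup G).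

(* [smallest C A] is the intersection of all the sets satisfying [C] that
   contain [A]. *)
Fact gen_is_subgroup (G : groupType) (A : set G) :
  is_subgroup (smallest (@is_subgroup G) A).
Proof.
split=> [H [[H1 _] _] //|x y Ax Ay H HP].
by case: (HP) => -[_ HF] _; apply: HF; [apply: Ax|apply: Ay].
Qed.

Definition gen_sg (G : groupType) (A : set G) : subgroup G :=
  Subgroup (gen_is_subgroup A).

Definition is_normal (G : groupType) (N : set G) : Prop :=
  is_subgroup N /\ forall x y, N x -> N (x ^ y).

Record normal_subgroup (G : groupType) := NormalSubgroup {
  nsg_sg :> subgroup G;
  nsgJ : forall x y, nsg_sg x -> nsg_sg (x ^ y) }.

Section Quotient.
Variables (G : groupType) (N : normal_subgroup G).

Definition coset_rel : rel G := fun x y => `[< N (x / y) >].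

Fact coset_rel_refl : reflexive coset_rel.
Proof. by move=> x; apply/asboolP; rewrite mulgV; apply: sg1. Qed.

Fact coset_rel_sym : symmetric coset_rel.
Proof.
move=> x y; apply/idP/idP => /asboolP Nxy; apply/asboolP;
  by rewrite -invgF; apply: sgV.
Qed.

Fact coset_rel_trans : transitive coset_rel.
Proof.
move=> y x z /asboolP Nxy /asboolP Nyz; apply/asboolP.
by rewrite -(divgKA y x z^-1); apply: sgM.
Qed.

Definition coset_equiv :=
  EquivRel coset_rel coset_rel_refl coset_rel_sym coset_rel_trans.

Definition quotient : Type := {eq_quot coset_equiv}.
HB.instance Definition _ := EqQuotient.on quotient.
HB.instance Definition _ := Choice.on quotient.

Local Notation pi := (\pi_quotient)%qT.

Definition quot_one : quotient := pi 1.
Definition quot_mul (a b : quotient) : quotient := pi (repr a * repr b).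
Definition quot_inv (a : quotient) : quotient := pi (repr a)^-1.

Lemma quot_eqP x y : pi x = pi y <-> N (x / y).
Proof.
split=> [/eqquotP /asboolP //|Nxy].
by apply/eqquotP; apply/asboolP.
Qed.

Lemma quot_reprP x : N (repr (pi x) / x).
Proof. by apply/quot_eqP; rewrite reprK. Qed.

Lemma quot_mulE x y : quot_mul (pi x) (pi y) = pi (x * y).
Proof.
apply/quot_eqP; set x' := repr _; set y' := repr _.
have -> : x' * y' / (x * y) = (x' / x) * ((y' / y) ^ x^-1).
  by rewrite conjgE invgK invgM !mulgA mulgVK.
by apply: sgM; [|apply: nsgJ]; apply: quot_reprP.
Qed.

Lemma quot_invE x : quot_inv (pi x) = pi x^-1.
Proof.
apply/quot_eqP; set x' := repr _.
have -> : x'^-1 / x^-1 = ((x' / x)^-1) ^ x.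
  by rewrite conjgE invgF invgK !mulgA mulVg mul1g.
by apply: nsgJ; apply: sgV; apply: quot_reprP.
Qed.

Fact quot_mulA : associative quot_mul.
Proof.
elim/quotW=> x; elim/quotW=> y; elim/quotW=> z.
by rewrite (quot_mulE y z) (quot_mulE x y) !quot_mulE mulgA.
Qed.

Fact quot_mul1 : left_id quot_one quot_mul.
Proof. by elim/quotW=> x; rewrite quot_mulE mul1g. Qed.

Fact quot_mulg1 : right_id quot_one quot_mul.
Proof. by elim/quotW=> x; rewrite quot_mulE mulg1. Qed.

Fact quot_mulV : left_inverse quot_one quot_inv quot_mul.
Proof. by elim/quotW=> x; rewrite quot_invE quot_mulE mulVg. Qed.

Fact quot_mulgV : right_inverse quot_one quot_inv quot_mul.
Proof. by elim/quotW=> x; rewrite quot_invE quot_mulE mulgV. Qed.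

HB.instance Definition _ := isGroup.Build quotient
  quot_mulA quot_mul1 quot_mulg1 quot_mulV quot_mulgV.

End Quotient.

(* [[~ x, y]] is [x^-1 * y^-1 * x * y]; the other usual convention generates the
   same subgroup. *)
Definition comm_sg (G : groupType) (H K : subgroup G) : subgroup G :=
  gen_sg [set [~ x, y] | x in sg_set H & y in sg_set K].

Definition Gamma2 (G : groupType) : subgroup G := comm_sg (setT_sg G) (setT_sg G).

Fixpoint derived (G : groupType) (n : nat) : subgroup G :=
  if n is m.+1 then comm_sg (derived G m) (derived G m) else setT_sg G.

Lemma comm_sgJ (G : groupType) (H : subgroup G) x y :
  H y -> comm_sg H H x -> comm_sg H H (x ^ y).
Proof.
move=> Hy Cx K [[K1 KF] sK].
suff [_ KJ]: K x /\ K (x ^ y) by [].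
rewrite -[_ /\ _]/((fun z => K z /\ K (z ^ y)) x).
apply: Cx; split.
  split=> [|a b [Ka Kay] [Kb Kby]]; first by rewrite conj1g.
  by rewrite conjMg conjVg; split; apply: KF.
move=> _ [a Ha] [b Hb] <-; split; first by apply: sK; exists a => //; exists b.
have HJ c : H c -> H (c ^ y).
  by move=> Hc; rewrite conjgE; apply: sgM; [apply: sgV|apply: sgM].
by rewrite conjRg; apply: sK; exists (a ^ y); [apply: HJ|exists (b ^ y); [apply: HJ|]].
Qed.

Definition Gamma2_nsg (G : groupType) : normal_subgroup G :=
  @NormalSubgroup G (Gamma2 G) (fun x y => @comm_sgJ G (setT_sg G) x y I).

Definition abelianization (G : groupType) : groupType := quotient (Gamma2_nsg G).

Section DerivedFactor.
Variables (G : groupType) (n : nat).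

Local Notation D := (subg_type (derived G n)).

Fact derived_next_is_subgroup : is_subgroup [set x : D | derived G n.+1 (val x)].
Proof.
split=> [|x y Dx Dy]; first exact: (sg1 (derived G n.+1)).
exact: (sgF Dx Dy).
Qed.

Fact derived_next_normal (x y : D) :
  derived G n.+1 (val x) -> derived G n.+1 (val (x ^ y)).
Proof. by move=> Dx; apply: comm_sgJ => //; apply: set_mem (valP y). Qed.

Definition derived_next : normal_subgroup D :=
  @NormalSubgroup D (Subgroup derived_next_is_subgroup) derived_next_normal.

End DerivedFactor.

(* [derived_next] is G^(n+1), a subset of G^(n), viewed as a subgroup of the group
   G^(n); hence this is G^(n) / G^(n+1). *)
Definition derived_factor (G : groupType) (n : nat) : groupType :=
  quotient (derived_next G n).

Section FreeGroup.
Variable I : choiceType.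

(* The letter [(i, true)] stands for the generator [i], and [(i, false)] for its
   inverse. *)
Definition word := seq (I * bool).
HB.instance Definition _ := Choice.on word.

Definition inv_letter (a : I * bool) : I * bool := (a.1, ~~ a.2).
Definition inv_word (w : word) : word := rev (map inv_letter w).

Inductive free_eq : word -> word -> Prop :=
| free_cancel (w1 w2 : word) a : free_eq (w1 ++ [:: a; inv_letter a] ++ w2) (w1 ++ w2)
| free_refl w : free_eq w w
| free_sym w1 w2 : free_eq w1 w2 -> free_eq w2 w1
| free_trans w1 w2 w3 : free_eq w1 w2 -> free_eq w2 w3 -> free_eq w1 w3.

Definition free_rel : rel word := fun w1 w2 => `[< free_eq w1 w2 >].

Fact free_rel_refl : reflexive free_rel.
Proof. by move=> w; apply/asboolP; apply: free_refl. Qed.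

Fact free_rel_sym : symmetric free_rel.
Proof. by move=> v w; apply/asboolP/asboolP; apply: free_sym. Qed.

Fact free_rel_trans : transitive free_rel.
Proof.
move=> w v x /asboolP vw /asboolP wx; apply/asboolP; exact: free_trans vw wx.
Qed.

Definition free_equiv :=
  EquivRel free_rel free_rel_refl free_rel_sym free_rel_trans.

Definition free_group : Type := {eq_quot free_equiv}.
HB.instance Definition _ := EqQuotient.on free_group.
HB.instance Definition _ := Choice.on free_group.

Local Notation pi := (\pi_free_group)%qT.

Definition free_gen (i : I) : free_group := pi [:: (i, true)].
Definition free_one : free_group := pi [::].
Definition free_mul (a b : free_group) : free_group := pi (repr a ++ repr b).
Definition free_inv (a : free_group) : free_group := pi (inv_word (repr a)).

Lemma free_eqP v w : pi v = pi w <-> free_eq v w.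
Proof.
split=> [/eqquotP /asboolP //|vw].
by apply/eqquotP; apply/asboolP.
Qed.

Lemma free_reprP w : free_eq (repr (pi w)) w.
Proof. by apply/free_eqP; rewrite reprK. Qed.

Lemma free_eq_catl u v w : free_eq v w -> free_eq (u ++ v) (u ++ w).
Proof.
elim=> [w1 w2 a|w1|w1 w2 _ IH|w1 w2 w3 _ IH1 _ IH2].
- by rewrite !(catA u); apply: free_cancel.
- exact: free_refl.
- exact: free_sym.
- exact: free_trans IH1 IH2.
Qed.

Lemma free_eq_catr u v w : free_eq v w -> free_eq (v ++ u) (w ++ u).
Proof.
elim=> [w1 w2 a|w1|w1 w2 _ IH|w1 w2 w3 _ IH1 _ IH2].
- by rewrite -!catA; apply: free_cancel.
- exact: free_refl.
- exact: free_sym.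
- exact: free_trans IH1 IH2.
Qed.

Lemma inv_letterK : involutive inv_letter.
Proof. by case=> i b; rewrite /inv_letter negbK. Qed.

Lemma inv_wordK : involutive inv_word.
Proof. by move=> w; rewrite /inv_word map_rev revK (mapK inv_letterK). Qed.

Lemma inv_word_cat v w : inv_word (v ++ w) = inv_word w ++ inv_word v.
Proof. by rewrite /inv_word map_cat rev_cat. Qed.

Lemma free_eq_inv v w : free_eq v w -> free_eq (inv_word v) (inv_word w).
Proof.
elim=> [w1 w2 a|w1|w1 w2 _ IH|w1 w2 w3 _ IH1 _ IH2].
- rewrite !inv_word_cat -catA {2}/inv_word /= /rev /= inv_letterK.
  have := free_cancel (inv_word w2) (inv_word w1) a.
  by [].
- exact: free_refl.
- exact: free_sym.
- exact: free_trans IH1 IH2.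
Qed.

Lemma free_eq_mulV w : free_eq (w ++ inv_word w) [::].
Proof.
elim: w => [|a w IH]; first exact: free_refl.
rewrite -cat1s inv_word_cat.
apply: free_trans (_ : free_eq ([:: a] ++ inv_word [:: a]) _).
  rewrite -!catA; apply: free_eq_catl.
  by rewrite catA; apply: (@free_eq_catr _ _ [::]).
exact: (free_cancel [::] [::] a).
Qed.

Lemma free_mulE v w : free_mul (pi v) (pi w) = pi (v ++ w).
Proof.
apply/free_eqP; apply: free_trans (free_eq_catr _ (free_reprP v)) _.
exact: free_eq_catl (free_reprP w).
Qed.

Lemma free_invE w : free_inv (pi w) = pi (inv_word w).
Proof. by apply/free_eqP; apply: free_eq_inv; apply: free_reprP. Qed.

Fact free_mulA : associative free_mul.
Proof.
elim/quotW=> x; elim/quotW=> y; elim/quotW=> z.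
by rewrite (free_mulE y z) (free_mulE x y) !free_mulE catA.
Qed.

Fact free_mul1 : left_id free_one free_mul.
Proof. by elim/quotW=> x; rewrite free_mulE. Qed.

Fact free_mulg1 : right_id free_one free_mul.
Proof. by elim/quotW=> x; rewrite free_mulE cats0. Qed.

Fact free_mulgV : right_inverse free_one free_inv free_mul.
Proof.
elim/quotW=> w; rewrite free_invE free_mulE.
by apply/free_eqP; apply: free_eq_mulV.
Qed.

Fact free_mulV : left_inverse free_one free_inv free_mul.
Proof.
elim/quotW=> w; rewrite free_invE free_mulE; apply/free_eqP.
by have := free_eq_mulV (inv_word w); rewrite inv_wordK.
Qed.

HB.instance Definition _ := isGroup.Build free_group
  free_mulA free_mul1 free_mulg1 free_mulV free_mulgV.

End FreeGroup.

Section NormalClosure.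
Variables (G : groupType) (A : set G).

Fact nclosure_is_subgroup : is_subgroup (smallest (@is_normal G) A).
Proof.
split=> [H [[[H1 _] _] _] //|x y Ax Ay H HP].
by case: (HP) => -[[_ HF] _] _; apply: HF; [apply: Ax|apply: Ay].
Qed.

Fact nclosureJ x y :
  smallest (@is_normal G) A x -> smallest (@is_normal G) A (x ^ y).
Proof.
by move=> Ax H HP; case: (HP) => -[_ HJ] _; apply: HJ; apply: Ax.
Qed.

Definition nclosure : normal_subgroup G :=
  @NormalSubgroup G (Subgroup nclosure_is_subgroup) nclosureJ.

End NormalClosure.

(* The group < I | r = 1, r in rels >. *)
Definition presented (I : choiceType) (rels : set (free_group I)) : groupType :=
  quotient (nclosure rels).

Section Braid4.

(* The Artin generators sigma_1, sigma_2, sigma_3, with indices shifted by 1. *)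
Let s1 : free_group 'I_3 := free_gen (@Ordinal 3 0 isT).
Let s2 : free_group 'I_3 := free_gen (@Ordinal 3 1 isT).
Let s3 : free_group 'I_3 := free_gen (@Ordinal 3 2 isT).

Definition braid4_rels : set (free_group 'I_3) :=
  [set r | [\/ r = (s1 * s3) / (s3 * s1),
               r = (s1 * s2 * s1) / (s2 * s1 * s2) |
               r = (s2 * s3 * s2) / (s3 * s2 * s3)]].

Definition B4 : groupType := presented braid4_rels.

End Braid4.

Definition F2 : groupType := free_group 'I_2.

Definition isomorphic (G H : groupType) : Prop :=
  exists f : {multiplicative G -> H}, bijective f.

(* The [groupType] law of ['Z_2] is addition modulo 2, not the ring product. *)
Definition Z2 : groupType := 'Z_2.

(* Main.v *)
Require Import Defs.
From HB Require Import structures.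
From mathcomp Require Import all_boot generic_quotient zmodp.
From mathcomp Require Import boolp classical_sets.

(* Write s1, s2, s3 for the Artin generators and put a = s1 s3^-1, b = s2 a
   s2^-1, u = s1^-1 s2, v = s2 s1^-1. Conjugation by s1 sends u to v and v to
   u^-1 v, and identifying s3 with s1 maps B4 onto B3 = F2(u, v) x| Z, with
   kernel <a, b>. Conjugation by the elements of B4^(1) makes a and b trivial
   in B4^(1) / B4^(2), hence B4^(2) = <a, b> x| [F2, F2]; in B4^(2) / B4^(3),
   where u v and v u act in the same way, it yields a^2 = b^2 = 1, so that
   <a, b> contributes at most Z2 x Z2. That it contributes no less is seen on
   the quotient M = (Z2 x Z2) x| B3 of B4, with projection Phi. Conversely, M
   maps to B4 / B4^(3) by a morphism Psi such that Psi o Phi is the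
   projection, so the kernel of Phi is contained in B4^(3). *)

Set Implicit Arguments.
Unset Strict Implicit.
Unset Printing Implicit Defensive.

Local Open Scope quotient_scope.
Local Open Scope group_scope.

Local Notation hom := UMagmaMorphism.type.

(** * Groups and morphisms *)

Lemma comm_sgR (G : groupType) (H K : subgroup G) x y :
  H x -> K y -> comm_sg H K [~ x, y].
Proof. by move=> Hx Ky L [_]; apply; exists x => //; exists y. Qed.

Lemma comm_sg_sub (G : groupType) (H K : subgroup G) (L : G -> Prop) :
  is_subgroup L -> (forall x y, H x -> K y -> L [~ x, y]) ->
  forall x, comm_sg H K x -> L x.
Proof.
by move=> sgL HKL x; apply; split=> // _ [y Hy [z Kz <-]]; apply: HKL.
Qed.

Lemma derivedJ (G : groupType) n x y : derived G n x -> derived G n (x ^ y).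
Proof.
elim: n x => //= n IH x.
apply: (@comm_sg_sub _ _ _ (fun x => derived G n.+1 (x ^ y))).
  split=> [|z t Dz Dt]; first by rewrite conj1g; apply: sg1.
  by rewrite conjMg conjVg; apply: sgF.
by move=> z t /IH Dz /IH Dt; rewrite conjRg; apply: comm_sgR.
Qed.

Definition derived_nsg (G : groupType) n : normal_subgroup G :=
  NormalSubgroup (@derivedJ G n).

Section Morphisms.
Variables (G H : groupType) (f : hom G H).

Lemma preim_is_subgroup (K : subgroup H) : is_subgroup (fun x => K (f x)).
Proof.
split=> [|x y Kx Ky]; first by rewrite gmulf1; apply: sg1.
by rewrite gmulfF; apply: sgF.
Qed.

Lemma ker_is_normal : is_normal (fun x => f x = 1).
Proof.
split=> [|x y fx]; last by rewrite gmulfJ fx conj1g.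
by split=> [|x y fx fy]; rewrite ?gmulf1 // gmulfF fx fy divg1.
Qed.

Lemma comm_sg_morph_eq1 (K L : subgroup G) :
  (forall x y, K x -> L y -> commute (f x) (f y)) ->
  forall x, comm_sg K L x -> f x = 1.
Proof.
move=> cKL; apply: comm_sg_sub.
  by case: ker_is_normal.
by move=> x y Kx Ly; rewrite gmulfR; apply/eqP/commgP/cKL.
Qed.

Lemma eq_morph_is_subgroup (g : hom G H) :
  is_subgroup (fun x => f x = g x).
Proof. by split=> [|x y fx fy]; rewrite ?gmulf1 // !gmulfF fx fy. Qed.

End Morphisms.

Lemma centraliser_is_subgroup (G : groupType) (A : G -> Prop) :
  is_subgroup (fun x => forall y, A y -> commute x y).
Proof.
split=> [y _|x y xA yA z Az]; first exact/commute_sym/commute1.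
apply: commute_sym; apply: commuteM; first exact/commute_sym/xA.
exact/commuteV/commute_sym/yA.
Qed.

(** Commuting with a fixed set of images is a subgroup condition, so [genA], which says that [A]
    generates [G], can be applied to each variable in turn. *)
Lemma morph_commute (G H : groupType) (f : hom G H) (A : G -> Prop) :
  (forall P, is_subgroup P -> (forall x, A x -> P x) -> forall x, P x) ->
  (forall x y, A x -> A y -> commute (f x) (f y)) ->
  forall x y, commute (f x) (f y).
Proof.
move=> genA cA x y.
have sgC B : is_subgroup (fun x => forall y, B y -> commute (f x) (f y)).
  have [C1 CF] :=
    @centraliser_is_subgroup H (fun z => exists2 y, B y & z = f y).
  split=> [z Bz|z t zB tB w Bw]; first by rewrite gmulf1; apply: C1; exists z.
  rewrite gmulfF; apply: CF; last by exists w.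
    by move=> _ [s Bs ->]; apply: zB.
  by move=> _ [s Bs ->]; apply: tB.
apply: (genA _ (sgC setT)) => // {}x Ax {}y _; apply: commute_sym.
by apply: (genA _ (sgC A)) => // {}y Ay z Az; apply: cA.
Qed.

Section QuotientMorphisms.
Variables (G : groupType) (N : normal_subgroup G).

Definition quot_pi : G -> quotient N := \pi_(quotient N).

Fact quot_piF : {morph quot_pi : x y / x / y}.
Proof.
move=> x y; rewrite -[LHS]quot_mulE; congr (_ * _).
by rewrite -[LHS]quot_invE.
Qed.

HB.instance Definition _ :=
  isGroupMorphism.Build G (quotient N) quot_pi quot_piF.

Lemma quot_pi_eq1 x : quot_pi x = 1 <-> N x.
Proof. by rewrite -[x in N x]divg1; apply: (quot_eqP N x 1). Qed.

Lemma quot_piP (y : quotient N) : exists x, y = quot_pi x.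
Proof. by exists (repr y); rewrite /quot_pi reprK. Qed.

Variables (H : groupType) (f : hom G H).

(* The unused argument lets [quot_lift Nf] carry the morphism structure. *)
Definition quot_lift of (forall x, N x -> f x = 1) :=
  fun (y : quotient N) => f (repr y).

Hypothesis Nf : forall x, N x -> f x = 1.

Lemma quot_lift_pi x : quot_lift Nf (quot_pi x) = f x.
Proof.
by apply: divg1_eq; rewrite /quot_lift -gmulfF; apply: Nf; apply: quot_reprP.
Qed.

Fact quot_liftF : {morph quot_lift Nf : x y / x / y}.
Proof.
move=> x y; have [[{}x ->] [{}y ->]] := (quot_piP x, quot_piP y).
by rewrite -gmulfF !quot_lift_pi gmulfF.
Qed.

HB.instance Definition _ :=
  isGroupMorphism.Build (quotient N) H (quot_lift Nf) quot_liftF.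

End QuotientMorphisms.

Lemma isomorphic_quotient (G H : groupType) (N : normal_subgroup G)
    (f : hom G H) :
  (forall x, N x <-> f x = 1) -> (forall y, exists x, f x = y) ->
  isomorphic (quotient N) H.
Proof.
move=> kerf surjf.
have Nf x : N x -> f x = 1 by move/kerf.
have surj y : exists x, f x == y by have [x <-] := surjf y; exists x.
suff bij : bijective (quot_lift Nf) by exists (quot_lift Nf).
exists (fun y => quot_pi N (xchoose (surj y))) => [x|y].
  have [{}x ->] := quot_piP x; rewrite quot_lift_pi; apply/quot_eqP/kerf.
  by rewrite gmulfF (eqP (xchooseP (surj (f x)))) mulgV.
by rewrite quot_lift_pi; apply/eqP/(xchooseP (surj y)).
Qed.

(** * Free and presented groups *)

Section FreeLift.
Variables (I : choiceType) (G : groupType).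

Lemma free_group_ind (P : free_group I -> Prop) :
  is_subgroup P -> (forall i, P (free_gen i)) -> forall x, P x.
Proof.
move=> sgP Pgen x; pose H := Subgroup sgP.
elim/quotW: x => w; elim: w => [|[i b] w IH]; first exact: (sg1 H).
rewrite -cat1s -free_mulE; apply: (@sgM _ H) => //.
case: b; first exact: Pgen.
have -> : \pi_(free_group I) [:: (i, false)] = (free_gen i)^-1.
  by rewrite [RHS]free_invE.
by apply: (@sgV _ H); apply: Pgen.
Qed.

Variable g : I -> G.

Definition eval_letter (a : I * bool) : G := if a.2 then g a.1 else (g a.1)^-1.
Definition eval_word (w : word I) : G :=
  foldr (fun a x => eval_letter a * x) 1 w.

Lemma eval_word_cat v w : eval_word (v ++ w) = eval_word v * eval_word w.
Proof. by elim: v => [|a v IH] /=; rewrite ?mul1g // IH mulgA. Qed.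

Lemma eval_word_eq v w : free_eq v w -> eval_word v = eval_word w.
Proof.
elim=> // [w1 w2 [i b]|w1 w2 w3 _ -> _ ->] //.
rewrite !eval_word_cat; congr (_ * _); rewrite -[RHS]mul1g; congr (_ * _).
by case: b; rewrite /eval_letter /= mulg1 (mulgV, mulVg).
Qed.

Definition free_lift (x : free_group I) : G := eval_word (repr x).

Lemma free_lift_pi w : free_lift (\pi w) = eval_word w.
Proof. exact/eval_word_eq/free_reprP. Qed.

Fact free_liftM : {morph free_lift : x y / x * y}.
Proof.
elim/quotW=> v; elim/quotW=> w.
rewrite [X in free_lift X](free_mulE v w).
by rewrite !free_lift_pi eval_word_cat.
Qed.

Fact free_lift1 : free_lift 1 = 1.
Proof. exact: free_lift_pi. Qed.

HB.instance Definition _ :=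
  isUMagmaMorphism.Build (free_group I) G free_lift (free_lift1, free_liftM).

Lemma free_lift_gen i : free_lift (free_gen i) = g i.
Proof. by rewrite free_lift_pi /= mulg1. Qed.

End FreeLift.

Section PresentedLift.
Variables (I : choiceType) (rels : set (free_group I)).
Variables (G : groupType) (g : I -> G).

Definition pres_gen i : presented rels := quot_pi (nclosure rels) (free_gen i).

Lemma presented_ind (P : presented rels -> Prop) :
  is_subgroup P -> (forall i, P (pres_gen i)) -> forall x, P x.
Proof.
move=> sgP Pgen x; have [{}x ->] := quot_piP x.
apply: (@free_group_ind _ (fun x => P (quot_pi (nclosure rels) x))) => //.
exact: (@preim_is_subgroup _ _ _ (Subgroup sgP)).
Qed.

Lemma pres_rel r : rels r -> quot_pi (nclosure rels) r = 1.
Proof. by move=> rr; apply/quot_pi_eq1 => H [_]; apply. Qed.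

Hypothesis rels1 : forall r, rels r -> free_lift g r = 1.

Fact nclosure_lift x : nclosure rels x -> free_lift g x = 1.
Proof.
move=> Nx; apply: (Nx (fun x => free_lift g x = 1)).
by split=> //; apply: ker_is_normal.
Qed.

Definition pres_lift : presented rels -> G := quot_lift nclosure_lift.
HB.instance Definition _ := UMagmaMorphism.on pres_lift.

Lemma pres_lift_gen i : pres_lift (pres_gen i) = g i.
Proof. by rewrite /pres_lift [LHS]quot_lift_pi; apply: free_lift_gen. Qed.

End PresentedLift.

(** * Automorphisms and semidirect products *)

Section Automorphisms.
Variable G : groupType.

Record autg := Autg {
  autg_fun :> G -> G;
  autg_inv : G -> G;
  autgM : {morph autg_fun : x y / x * y};
  autgK : cancel autg_fun autg_inv;
  autgVK : cancel autg_inv autg_fun }.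

HB.instance Definition _ := gen_eqMixin autg.
HB.instance Definition _ := gen_choiceMixin autg.

(** The function determines its two-sided inverse, and the remaining fields are proofs. *)
Lemma autg_eq (s t : autg) : s =1 t -> s = t.
Proof.
case: s t => [f g fM fK gK] [f' g' f'M f'K g'K] /= /funext eqf; subst f'.
have eqg : g = g' by apply/funext => x; rewrite -{1}(g'K x) fK.
by subst g'; congr Autg; apply: Prop_irrelevance.
Qed.

Fact autg1 (s : autg) : s 1 = 1.
Proof. by apply: (mulgI (s 1)); rewrite -autgM !mulg1. Qed.

HB.instance Definition _ (s : autg) :=
  isUMagmaMorphism.Build G G s (autg1 s, autgM s).

Definition autg_one : autg :=
  @Autg id id (fun _ _ => erefl) (frefl _) (frefl _).

Fact autg_mulM (s t : autg) : {morph s \o t : x y / x * y}.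
Proof. by move=> x y /=; rewrite !autgM. Qed.

Definition autg_mul (s t : autg) : autg :=
  Autg (autg_mulM s t) (can_comp (autgK s) (autgK t))
       (can_comp (autgVK t) (autgVK s)).

Fact autg_invM (s : autg) : {morph autg_inv s : x y / x * y}.
Proof. exact: can2_gmulfM (autgK s) (autgVK s). Qed.

Definition autg_invg (s : autg) : autg :=
  Autg (autg_invM s) (autgVK s) (autgK s).

Fact autg_mulA : associative autg_mul.
Proof. by move=> s t w; apply: autg_eq. Qed.
Fact autg_mul1 : left_id autg_one autg_mul.
Proof. by move=> s; apply: autg_eq. Qed.
Fact autg_mulg1 : right_id autg_one autg_mul.
Proof. by move=> s; apply: autg_eq. Qed.
Fact autg_mulV : left_inverse autg_one autg_invg autg_mul.
Proof. by move=> s; apply: autg_eq => x /=; rewrite autgK. Qed.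
Fact autg_mulgV : right_inverse autg_one autg_invg autg_mul.
Proof. by move=> s; apply: autg_eq => x /=; rewrite autgVK. Qed.

HB.instance Definition _ := isGroup.Build autg
  autg_mulA autg_mul1 autg_mulg1 autg_mulV autg_mulgV.

End Automorphisms.

Section SemidirectProduct.
Variables (G H : groupType).

(** Indexing the type by the action keeps the twisted law apart from the componentwise law on
    [G * H]. *)
Definition sdprod of hom H (autg G) : Type := (G * H)%type.

Variable th : hom H (autg G).

HB.instance Definition _ := Choice.on (sdprod th).

Definition sd_mul (x y : sdprod th) : sdprod th :=
  (x.1 * th x.2 y.1, x.2 * y.2).
Definition sd_inv (x : sdprod th) : sdprod th := (th x.2^-1 x.1^-1, x.2^-1).

Lemma sd_actM h k g : th (h * k) g = th h (th k g).
Proof. by rewrite gmulfM. Qed.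
Lemma sd_act1 g : th 1 g = g.
Proof. by rewrite gmulf1. Qed.

Fact sd_mulA : associative sd_mul.
Proof. by move=> x y z; rewrite /sd_mul /= gmulfM sd_actM !mulgA. Qed.
Fact sd_mul1 : left_id (1, 1) sd_mul.
Proof. by case=> g h; rewrite /sd_mul /= sd_act1 !mul1g. Qed.
Fact sd_mulg1 : right_id (1, 1) sd_mul.
Proof. by case=> g h; rewrite /sd_mul /= gmulf1 !mulg1. Qed.
Fact sd_mulV : left_inverse (1, 1) sd_inv sd_mul.
Proof. by case=> g h; rewrite /sd_mul /= -gmulfM !mulVg gmulf1. Qed.
Fact sd_mulgV : right_inverse (1, 1) sd_inv sd_mul.
Proof. by case=> g h; rewrite /sd_mul /= -sd_actM mulgV sd_act1 !mulgV. Qed.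

HB.instance Definition _ := isGroup.Build (sdprod th)
  sd_mulA sd_mul1 sd_mulg1 sd_mulV sd_mulgV.

Definition sd_inl (g : G) : sdprod th := (g, 1).
Definition sd_inr (h : H) : sdprod th := (1, h).
Definition sd_snd (x : sdprod th) : H := x.2.

Fact sd_inlM : {morph sd_inl : x y / x * y}.
Proof. by move=> x y; congr (_, _); rewrite /= ?sd_act1 ?mulg1. Qed.
Fact sd_inrM : {morph sd_inr : x y / x * y}.
Proof. by move=> x y; congr (_, _); rewrite /= gmulf1 mulg1. Qed.

HB.instance Definition _ :=
  isUMagmaMorphism.Build G (sdprod th) sd_inl (erefl, sd_inlM).
HB.instance Definition _ :=
  isUMagmaMorphism.Build H (sdprod th) sd_inr (erefl, sd_inrM).
HB.instance Definition _ :=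
  isUMagmaMorphism.Build (sdprod th) H sd_snd (erefl, fun _ _ => erefl).

Lemma sd_split (x : sdprod th) : x = sd_inl x.1 * sd_inr x.2.
Proof. by case: x => g h; congr (_, _); rewrite /= (gmulf1, mul1g) ?mulg1. Qed.

Variables (L : groupType) (a : hom G L) (b : hom H L).

Definition sd_lift of (forall h g, b h * a g = a (th h g) * b h) :=
  fun x : sdprod th => a x.1 * b x.2.

Hypothesis ab : forall h g, b h * a g = a (th h g) * b h.

Fact sd_liftM : {morph sd_lift ab : x y / x * y}.
Proof.
move=> [g h] [g' h']; rewrite /sd_lift /= !gmulfM -!mulgA; congr (_ * _).
by rewrite !mulgA ab.
Qed.
Fact sd_lift1 : sd_lift ab 1 = 1.
Proof. by rewrite /sd_lift !gmulf1 mulg1. Qed.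

HB.instance Definition _ :=
  isUMagmaMorphism.Build (sdprod th) L (sd_lift ab) (sd_lift1, sd_liftM).

Lemma sd_lift_inl g : sd_lift ab (sd_inl g) = a g.
Proof. by rewrite /sd_lift /= gmulf1 mulg1. Qed.
Lemma sd_lift_inr h : sd_lift ab (sd_inr h) = b h.
Proof. by rewrite /sd_lift /= gmulf1 mul1g. Qed.

End SemidirectProduct.

Section SemidirectCompatibility.
Variables (G H L : groupType) (th : hom H (autg G)).
Variables (a : hom G L) (b : hom H L).

(** The condition required by [sd_lift] may be checked on generators of [H] and, by
    [sd_compat_right_is_subgroup], for each of them on generators of [G]. *)
Lemma sd_compat_is_subgroup :
  is_subgroup (fun h => forall g, b h * a g = a (th h g) * b h).
Proof.
split=> [g|h k Ph Pk g]; first by rewrite !gmulf1 mulg1 mul1g.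
rewrite gmulfF -mulgA.
have -> : (b k)^-1 * a g = a (th k^-1 g) * (b k)^-1.
  apply: (mulgI (b k)).
  by rewrite !mulgA Pk -sd_actM !mulgV sd_act1 mulgK mul1g.
by rewrite mulgA Ph -sd_actM mulgA.
Qed.

Lemma sd_compat_right_is_subgroup h :
  is_subgroup (fun g => b h * a g = a (th h g) * b h).
Proof.
split=> [|x y Px Py]; first by rewrite !gmulf1 mulg1 mul1g.
by rewrite !gmulfF mulgA Px -!mulgA; congr (_ * _);
  apply: (mulIg (a y)); rewrite -!mulgA mulVg mulg1 Py mulKg.
Qed.

End SemidirectCompatibility.

Arguments sd_inl {G H} th g.
Arguments sd_inr {G H} th h.

Ltac cancel_group := rewrite ?(invgM, invgK, mulgA, mulgK, mulgVK, mulgV, mulVg,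
  mul1g, mulg1, invg1).

Lemma sd_conj (G H : groupType) (th : hom H (autg G)) h g g' :
  th h g = g' -> sd_inr th h * sd_inl th g = sd_inl th g' * sd_inr th h.
Proof. by move=> <-; congr (_, _); rewrite /= ?(mul1g, mulg1, gmulf1). Qed.

Lemma sdprod_ind (G H : groupType) (th : hom H (autg G))
    (P : sdprod th -> Prop) :
  is_subgroup P -> (forall g, P (sd_inl th g)) -> (forall h, P (sd_inr th h)) ->
  forall x, P x.
Proof.
by move=> sgP Pl Pr x; rewrite (sd_split x); apply: (@sgM _ (Subgroup sgP)).
Qed.

(** * The quotient (Z2 x Z2) x| B3 of B4 *)

Section RankTwo.
Variable G : groupType.

Definition pair_gens (x y : G) (i : 'I_2) : G := if val i == 0 then x else y.
Definition F2_lift x y : F2 -> G := free_lift (pair_gens x y).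
HB.instance Definition _ x y := UMagmaMorphism.on (F2_lift x y).

End RankTwo.

Definition fu : F2 := free_gen (@Ordinal 2 0 isT).
Definition fv : F2 := free_gen (@Ordinal 2 1 isT).

Lemma F2_lift_u (G : groupType) (x y : G) : F2_lift x y fu = x.
Proof. exact: free_lift_gen. Qed.
Lemma F2_lift_v (G : groupType) (x y : G) : F2_lift x y fv = y.
Proof. exact: free_lift_gen. Qed.

Lemma F2_ind (P : F2 -> Prop) : is_subgroup P -> P fu -> P fv -> forall x, P x.
Proof.
move=> sgP Pu Pv; apply: free_group_ind => // -[[|[|//]] lti].
  by rewrite (_ : Ordinal lti = @Ordinal 2 0 isT) //; apply: val_inj.
by rewrite (_ : Ordinal lti = @Ordinal 2 1 isT) //; apply: val_inj.
Qed.

Lemma F2_eq_morph (G : groupType) (f g : hom F2 G) :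
  f fu = g fu -> f fv = g fv -> f =1 g.
Proof. by move=> fgu fgv; apply: F2_ind => //; apply: eq_morph_is_subgroup. Qed.

(** The infinite cyclic group, taken as a free group on one letter so that [free_lift] gives its
    morphisms. *)
Definition Zgrp : groupType := free_group unit.
Definition zt : Zgrp := free_gen tt.

Definition tau_fun : F2 -> F2 := F2_lift fv (fu^-1 * fv).
Definition tau_inv : F2 -> F2 := F2_lift (fu / fv) fu.
HB.instance Definition _ := UMagmaMorphism.on tau_fun.
HB.instance Definition _ := UMagmaMorphism.on tau_inv.

Lemma tau_u : tau_fun fu = fv. Proof. exact: F2_lift_u. Qed.
Lemma tau_v : tau_fun fv = fu^-1 * fv. Proof. exact: F2_lift_v. Qed.
Lemma tau_inv_u : tau_inv fu = fu / fv. Proof. exact: F2_lift_u. Qed.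
Lemma tau_inv_v : tau_inv fv = fu. Proof. exact: F2_lift_v. Qed.

Fact tau_funK : cancel tau_fun tau_inv.
Proof.
apply: (@F2_eq_morph _ (tau_inv \o tau_fun) idfun) => /=.
  by rewrite tau_u tau_inv_v.
by rewrite tau_v gmulfM gmulfV /= tau_inv_u tau_inv_v; cancel_group.
Qed.

Fact tau_invK : cancel tau_inv tau_fun.
Proof.
apply: (@F2_eq_morph _ (tau_fun \o tau_inv) idfun) => /=.
  by rewrite tau_inv_u gmulfF /= tau_u tau_v; cancel_group.
by rewrite tau_inv_v tau_u.
Qed.

Definition tau : autg F2 := Autg (@gmulfM _ _ tau_fun) tau_funK tau_invK.

Definition thK : hom Zgrp (autg F2) := free_lift (fun _ => tau).

Lemma thK_t x : thK zt x = tau_fun x.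
Proof. by rewrite /thK /= free_lift_gen. Qed.

(* [K] is the three-strand braid group; its commutator subgroup is the free
   factor [F2]. *)
Definition K : groupType := sdprod thK.
Definition ku : K := sd_inl thK fu.
Definition kv : K := sd_inl thK fv.
Definition kt : K := sd_inr thK zt.

Lemma K_ind (P : K -> Prop) :
  is_subgroup P -> P ku -> P kv -> P kt -> forall x, P x.
Proof.
move=> sgP Pu Pv Pt; apply: sdprod_ind => // [|h].
  exact: (F2_ind (preim_is_subgroup (sd_inl thK) (Subgroup sgP))).
have sgPr := preim_is_subgroup (sd_inr thK) (Subgroup sgP).
by apply: (free_group_ind sgPr) => -[].
Qed.

(** It suffices to test [zt] against [fu] and [fv], and the hypotheses are these two tests. Hence
    [x], [y], [z] define a morphism out of [K]. *)
Lemma K_lift_compat (L : groupType) (x y : L) (z : L) :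
  z * x = y * z -> z * y = x^-1 * y * z ->
  forall h f, free_lift (fun _ => z) h * F2_lift x y f
    = F2_lift x y (thK h f) * free_lift (fun _ => z) h.
Proof.
move=> zx zy; apply: free_group_ind; first exact: sd_compat_is_subgroup.
move=> []; apply: F2_ind; first exact: sd_compat_right_is_subgroup.
  by rewrite free_lift_gen thK_t tau_u F2_lift_u F2_lift_v.
by rewrite free_lift_gen thK_t tau_v gmulfM gmulfV /= F2_lift_u F2_lift_v.
Qed.

Definition V4 : groupType := (Z2 * Z2)%type.
Definition z1 : Z2 := @Ordinal 2 1 isT.
Definition va : V4 := (z1, 1).
Definition vb : V4 := (1, z1).

Lemma Z2_cases (x : Z2) : x = 1 \/ x = z1.
Proof. by case: x => -[|[|//]] ltx; [left|right]; apply: val_inj. Qed.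

Lemma V4_cases (x : V4) : [\/ x = 1, x = va, x = vb | x = va * vb].
Proof.
case: x => i j.
by case: (Z2_cases i) (Z2_cases j) => -> [] ->;
  [constructor 1|constructor 3|constructor 2|constructor 4];
  congr (_, _); apply: val_inj.
Qed.

Lemma Z2_commute (x y : Z2) : commute x y.
Proof. by case: (Z2_cases x) (Z2_cases y) => -> [] ->; apply: val_inj. Qed.

Lemma V4_commute (x y : V4) : commute x y.
Proof. by congr (_, _); apply: Z2_commute. Qed.

Lemma V4_sqr (x : V4) : x * x = 1.
Proof. by case: (V4_cases x) => ->; congr (_, _); apply: val_inj. Qed.

Lemma V4_ind (P : V4 -> Prop) : is_subgroup P -> P va -> P vb -> forall x, P x.
Proof.
move=> sgP Pa Pb x; pose H := Subgroup sgP.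
case: (V4_cases x) => -> //; first exact: (sg1 H).
exact: (@sgM _ H).
Qed.

(* [rho], [rho^-1] and [swap] are the conjugations of a, b by u, v and s1, read
   modulo 2. *)
Definition rho_fun (x : V4) : V4 := (x.1 * x.2, x.1).
Definition rho_inv (x : V4) : V4 := (x.2, x.1 * x.2).
Definition swap_fun (x : V4) : V4 := (x.1 * x.2, x.2).

Ltac V4_case x := case: (V4_cases x) => ->.
Ltac V4_dec := congr (_, _); apply: val_inj.

Fact rhoM : {morph rho_fun : x y / x * y}.
Proof. by move=> x y; V4_case x; V4_case y; V4_dec. Qed.
Fact rhoK : cancel rho_fun rho_inv.
Proof. by move=> x; V4_case x; V4_dec. Qed.
Fact rhoVK : cancel rho_inv rho_fun.
Proof. by move=> x; V4_case x; V4_dec. Qed.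
Fact swapM : {morph swap_fun : x y / x * y}.
Proof. by move=> x y; V4_case x; V4_case y; V4_dec. Qed.
Fact swapK : involutive swap_fun.
Proof. by move=> x; V4_case x; V4_dec. Qed.

Definition rho : autg V4 := Autg rhoM rhoK rhoVK.
Definition swap : autg V4 := Autg swapM swapK swapK.

Lemma swap_rho : swap * rho = rho^-1 * swap.
Proof. by apply: autg_eq => x; V4_case x; V4_dec. Qed.
Lemma swap_rhoV : swap * rho^-1 = rho^-1 * rho^-1 * swap.
Proof. by apply: autg_eq => x; V4_case x; V4_dec. Qed.

(** The action factors through the automorphism group of [V4], which is symmetric of degree 3: [rho]
    has order 3 and [swap] is an involution inverting it. *)
Definition thM : hom K (autg V4) := sd_lift (K_lift_compat swap_rho swap_rhoV).

Lemma thM_f f : thM (sd_inl thK f) = F2_lift rho rho^-1 f.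
Proof. exact: sd_lift_inl. Qed.
Lemma thM_u : thM ku = rho. Proof. by rewrite thM_f F2_lift_u. Qed.
Lemma thM_v : thM kv = rho^-1. Proof. by rewrite thM_f F2_lift_v. Qed.
Lemma thM_t : thM kt = swap.
Proof. by rewrite [LHS]sd_lift_inr /= free_lift_gen. Qed.

Definition M : groupType := sdprod thM.
Definition mA : M := sd_inl thM va.
Definition mB : M := sd_inl thM vb.
Definition mU : M := sd_inr thM ku.
Definition mV : M := sd_inr thM kv.
Definition mT : M := sd_inr thM kt.

Lemma mTA : mT * mA = mA * mT.
Proof. by apply: sd_conj; rewrite thM_t; V4_dec. Qed.
Lemma mVA : mV * mA = mB * mV.
Proof. by apply: sd_conj; rewrite thM_v; V4_dec. Qed.
Lemma mUVB : mU^-1 * mB = mA * mB * mU^-1.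
Proof.
rewrite -[mU^-1]gmulfV -[mA * mB]gmulfM; apply: sd_conj.
by rewrite gmulfV thM_u; V4_dec.
Qed.
Lemma mA_sqr : mA * mA = 1.
Proof. by rewrite -[LHS]gmulfM V4_sqr gmulf1. Qed.

Lemma ktu : kt * ku = kv * kt.
Proof. by apply: sd_conj; rewrite thK_t tau_u. Qed.
Lemma ktv : kt * kv = ku^-1 * kv * kt.
Proof.
rewrite -[ku^-1]gmulfV -[sd_inl _ _ * kv]gmulfM; apply: sd_conj.
by rewrite thK_t tau_v.
Qed.

Lemma mTU : mT * mU = mV * mT.
Proof. by rewrite -[LHS]gmulfM ktu gmulfM. Qed.
Lemma mTV : mT * mV = mU^-1 * mV * mT.
Proof. by rewrite -[LHS]gmulfM ktv !gmulfM gmulfV. Qed.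

(** * The Artin generators and the morphism from B4 to M *)

Definition s1 : B4 := pres_gen braid4_rels (@Ordinal 3 0 isT).
Definition s2 : B4 := pres_gen braid4_rels (@Ordinal 3 1 isT).
Definition s3 : B4 := pres_gen braid4_rels (@Ordinal 3 2 isT).

Lemma B4_ind (P : B4 -> Prop) :
  is_subgroup P -> P s1 -> P s2 -> P s3 -> forall x, P x.
Proof.
move=> sgP P1 P2 P3; apply: presented_ind => // -[[|[|[|//]]] lti].
- by rewrite (_ : Ordinal lti = @Ordinal 3 0 isT) //; apply: val_inj.
- by rewrite (_ : Ordinal lti = @Ordinal 3 1 isT) //; apply: val_inj.
- by rewrite (_ : Ordinal lti = @Ordinal 3 2 isT) //; apply: val_inj.
Qed.

Lemma braid_rel r r' :
  braid4_rels (r / r') -> quot_pi (nclosure braid4_rels) r = quot_pi _ r'.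
Proof. by move=> rr; apply: divg1_eq; rewrite -gmulfF; apply: pres_rel. Qed.

Lemma s1_s3 : s1 * s3 = s3 * s1.
Proof. by have := braid_rel (Or31 _ _ erefl); rewrite !gmulfM. Qed.
Lemma s1_s2 : s1 * s2 * s1 = s2 * s1 * s2.
Proof. by have := braid_rel (Or32 _ _ erefl); rewrite !gmulfM. Qed.
Lemma s2_s3 : s2 * s3 * s2 = s3 * s2 * s3.
Proof. by have := braid_rel (Or33 _ _ erefl); rewrite !gmulfM. Qed.

Definition sa : B4 := s1 / s3.
Definition sb : B4 := s2 * sa / s2.
Definition su : B4 := s1^-1 * s2.
Definition sv : B4 := s2 / s1.

Section BraidLift.
Variables (G : groupType) (x1 x2 x3 : G).
Hypotheses (x13 : x1 * x3 = x3 * x1) (x121 : x1 * x2 * x1 = x2 * x1 * x2)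
           (x232 : x2 * x3 * x2 = x3 * x2 * x3).

Definition triple_gens (i : 'I_3) : G :=
  match val i with 0 => x1 | 1 => x2 | _ => x3 end.

Fact braid_lift_rel r : braid4_rels r -> free_lift triple_gens r = 1.
Proof.
by case=> ->; rewrite gmulfF !gmulfM /= !free_lift_gen /=;
  rewrite (x13, x121, x232) mulgV.
Qed.

Definition braid_lift : hom B4 G := pres_lift braid_lift_rel.

Lemma braid_lift1 : braid_lift s1 = x1. Proof. exact: pres_lift_gen. Qed.
Lemma braid_lift2 : braid_lift s2 = x2. Proof. exact: pres_lift_gen. Qed.
Lemma braid_lift3 : braid_lift s3 = x3. Proof. exact: pres_lift_gen. Qed.
End BraidLift.

Section ModelRelations.
Variables (G : groupType) (A B U V T : G).
Hypotheses (AA : A * A = 1) (TA : T * A = A * T) (VA : V * A = B * V)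
  (UVB : U^-1 * B = A * B * U^-1) (TU : T * U = V * T)
  (TV : T * V = U^-1 * V * T).

(** Conjugation by T sends V to U^-1 V and U to V, hence U^-1 V to V^-1 (U^-1 V). *)
Lemma TTV : T * T * V = V^-1 * U^-1 * V * T * T.
Proof.
have TUV : T * U^-1 = V^-1 * T.
  by apply: (mulgI V); apply: (mulIg U); rewrite !mulgA mulgV mul1g mulgVK TU.
by rewrite -mulgA TV !mulgA TUV -(mulgA _ T V) TV !mulgA.
Qed.

Lemma model_s121 : T * (V * T) * T = V * T * T * (V * T).
Proof.
by rewrite !mulgA TV -(mulgA V) -(mulgA V) TTV !mulgA mulgV mul1g.
Qed.

Lemma model_s232 : V * T * (A * T) * (V * T) = A * T * (V * T) * (A * T).
Proof.
have -> : V * T * (A * T) * (V * T) = B * U^-1 * V * T * T * T.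
  rewrite !mulgA -(mulgA V) TA !mulgA VA -!mulgA [T * (T * _)]mulgA.
  by rewrite [T * T * _]mulgA TTV !mulgA mulgK.
have -> : A * T * (V * T) * (A * T) = A * U^-1 * V * A * T * T * T.
  rewrite !mulgA -(mulgA A) TV !mulgA -(mulgA _ T A) TA !mulgA.
  by rewrite -(mulgA _ T A) TA !mulgA.
(* With T^3 removed, B U^-1 V is compared with A U^-1 V A. Moved to the left, the last A becomes B
   across V, then A B across U^-1, and A^2 = 1 finishes. *)
congr (_ * _ * _ * _); rewrite -(mulgA _ V) VA !mulgA -(mulgA A) UVB !mulgA.
by rewrite AA mul1g.
Qed.

End ModelRelations.

Lemma mT_mAT : mT * (mA * mT) = mA * mT * mT.
Proof. by rewrite mulgA mTA. Qed.

(** The images come from s2 = v s1 and s3 = a^-1 s1, where a^-1 and a have the same image in [M]. *)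
Definition Phi : hom B4 M := braid_lift mT_mAT (model_s121 mTU mTV)
  (model_s232 mA_sqr mTA mVA mUVB mTU mTV).

Lemma Phi1 : Phi s1 = mT. Proof. exact: braid_lift1. Qed.
Lemma Phi2 : Phi s2 = mV * mT. Proof. exact: braid_lift2. Qed.
Lemma Phi3 : Phi s3 = mA * mT. Proof. exact: braid_lift3. Qed.

(** * Relations in B4 and in B4 / B4^(3) *)

Lemma braid_conj (G : groupType) (x y : G) :
  x * y * x = y * x * y -> x^-1 * y * x = y * x * y^-1.
Proof. by move=> xy; apply: (mulgI x); rewrite !mulgA xy mulgV mul1g mulgK. Qed.

Lemma braid_conjV (G : groupType) (x y : G) :
  x * y * x = y * x * y -> y^-1 * x^-1 * y = x * y^-1 * x^-1.
Proof.
move=> xy; apply: (mulgI (x * y)).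
by rewrite !mulgA mulgK mulgV mul1g xy !mulgK.
Qed.

Section BraidIdentities.
Variables (G : groupType) (x1 x2 x3 : G).
Hypotheses (x13 : x1 * x3 = x3 * x1) (x121 : x1 * x2 * x1 = x2 * x1 * x2)
           (x232 : x2 * x3 * x2 = x3 * x2 * x3).

Let a := x1 / x3.
Let b := x2 * a / x2.

Lemma braid_1a : x1 * a = a * x1.
Proof. exact: commuteM (commute_refl x1) (commuteV x13). Qed.

Lemma braid_2a : x2 * a = b * x2.
Proof. by rewrite mulgVK. Qed.

(** Together with [braid_1a], [braid_2a] and [braid_2b], this determines how x1 and x2 act by
    conjugation on the subgroup generated by a and b. *)
Lemma braid_1b : x1 * b = b / a * x1.
Proof.
rewrite /b /a; cancel_group; rewrite x121 -!(mulgA (x2 * x1)).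
by rewrite (braid_conjV x232).
Qed.

Lemma braid_2b : x2 * b = b / a * b * x2.
Proof.
have x13V : x3^-1 * x1 = x1 * x3^-1 by exact/commute_sym/commuteV.
have x232V : x3^-1 * x2^-1 * x3^-1 = x2^-1 * x3^-1 * x2^-1.
  by apply: invg_inj; rewrite !invgM !invgK !mulgA -x232.
(* The bracketed factors are a conjugate of x2^-1 by x3 and one of x2 by x1, to which the braid
   relations apply. *)
rewrite [RHS](_ : _ = x2 * x1 * (x3^-1 * x2^-1 * x3)
  * (x1^-1 * x2 * x1) * x3^-1); last by rewrite /b /a; cancel_group.
rewrite (braid_conjV x232) (braid_conj x121); cancel_group.
rewrite -(mulgA _ x3^-1 x1) x13V -!(mulgA (x2 * x1 * x2)).
rewrite -!(mulgA x1) x232V !mulgA; congr (_ * _ * _).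
by rewrite -(mulgA x2 x1 x2) -(mulgA x2 (x1 * x2)) x121 !mulgA mulgK.
Qed.

End BraidIdentities.

Section BraidActions.
Variables (G : groupType) (x1 x2 a b : G).
Hypotheses (x121 : x1 * x2 * x1 = x2 * x1 * x2)
  (x1a : x1 * a = a * x1) (x2a : x2 * a = b * x2)
  (x1b : x1 * b = b / a * x1) (x2b : x2 * b = b / a * b * x2).

Let u := x1^-1 * x2.
Let v := x2 / x1.

Lemma braid_1u : x1 * u = v * x1.
Proof. by rewrite mulVKg mulgVK. Qed.

Lemma braid_1v : x1 * v = u^-1 * v * x1.
Proof. by rewrite /u /v; cancel_group; rewrite (braid_conj (esym x121)). Qed.

Let x1Va : x1^-1 * a = a * x1^-1.
Proof. exact/commute_sym/commuteV/commute_sym. Qed.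

Let x1Vb : x1^-1 * b = b * a * x1^-1.
Proof.
apply: (mulgI x1); rewrite mulVKg !mulgA x1b -(mulgA _ x1 a) x1a.
by cancel_group.
Qed.

(** Conjugation by u is conjugation by x2 followed by conjugation by x1^-1; for v the order is
    reversed. *)
Lemma braid_ua : u * a = b * a * u.
Proof. by rewrite -mulgA x2a mulgA x1Vb !mulgA. Qed.

Lemma braid_ub : u * b = b * b * a * u.
Proof.
rewrite -mulgA x2b !mulgA x1Vb -(mulgA _ x1^-1).
have -> : x1^-1 / a = a^-1 / x1 by exact: commuteV.
by rewrite mulgA mulgK -(mulgA _ x1^-1) x1Vb !mulgA.
Qed.

Lemma braid_va : v * a = b * v.
Proof. by rewrite -mulgA x1Va mulgA x2a mulgA. Qed.

Lemma braid_vb : v * b = b / a * b * b * v.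
Proof. by rewrite -mulgA x1Vb 2!mulgA x2b -(mulgA _ x2 a) x2a !mulgA. Qed.

End BraidActions.

Section CommutingAction.
Variables (Q : groupType) (u v a b g : Q).
Hypotheses (ua : u * a = b * a * u) (ub : u * b = b * b * a * u)
  (va : v * a = b * v) (vb : v * b = b / a * b * b * v).
Hypotheses (uv : u * v = g * v * u) (ga : commute g a) (gb : commute g b)
  (ab : commute a b).

(* [g] is the commutator of [u] and [v], so [u * v] and [v * u] conjugate [x] to
   the same element as soon as [g] commutes with the conjugates. *)
Let uvVu x y z :
  commute g y -> u * v * x = z * u * v -> v * u * x = y * v * u -> z = y.
Proof.
move=> gy zE yE; apply: (mulIg u); apply: (mulIg v).
by rewrite -zE uv -2!mulgA [v * _]mulgA yE !mulgA gy -!mulgA [g * _]mulgA -uv.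
Qed.

Let gaV : commute g a^-1. Proof. exact: commuteV. Qed.

(** Comparing the actions of u v and v u on a gives b^2 a = b a^-1 b^3, which is a^2 = b^2 because a
    and b commute. *)
Lemma action_sqr_eq : a * a = b * b.
Proof.
have : b * b * a = b / a * b * b * b.
  apply: (@uvVu a); first by do !apply: commuteM.
    by rewrite -mulgA va mulgA ub.
  by rewrite -mulgA ua !mulgA vb -!(mulgA _ v) va !mulgA.
rewrite -!(mulgA b) => /mulgI /(congr1 (fun x => a * x)).
by rewrite !mulgA mulgV mul1g ab -!(mulgA b) => /mulgI.
Qed.

(** The same comparison on b gives b^5 a^2 = (b a^-1 b^2)^2 b, up to commuting a with b. Since a^2 =
    b^2, the factor b a^-1 b^2 is b a, so the right-hand side is b^3 a^2. *)
Lemma action_sqr1 : b * b = 1.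
Proof.
have uaV : u * a^-1 = (b * a)^-1 * u.
  by apply: (mulgI (b * a)); rewrite mulgA -ua !mulgA mulgK mulgV mul1g.
have : b * b * a * (b * a)^-1 * (b * b * a) * (b * b * a)
       = (b / a * b * b) * (b / a * b * b) * b.
  apply: (@uvVu b); first by do !apply: commuteM.
    rewrite -mulgA vb !mulgA ub -!(mulgA _ u) uaV !(mulgA, ub).
    by rewrite -!(mulgA _ u) ub !mulgA -!(mulgA _ u) ub !mulgA.
  rewrite -mulgA ub !mulgA vb -!(mulgA _ v) vb !mulgA.
  by rewrite -!(mulgA _ v) va !mulgA.
have abA x : x * a * b = x * b * a by rewrite -mulgA ab mulgA.
have -> : b / a * b * b = b * a by rewrite -mulgA -action_sqr_eq; cancel_group.
cancel_group; rewrite !abA => /mulIg /mulIg.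
rewrite -[b * b * b in RHS]mul1g !mulgA.
by do 3!move/mulIg.
Qed.

End CommutingAction.

Lemma s2_a : s2 * sa = sb * s2. Proof. exact: braid_2a. Qed.
Lemma s1_a : s1 * sa = sa * s1. Proof. exact: braid_1a s1_s3. Qed.
Lemma s1_b : s1 * sb = sb / sa * s1. Proof. exact: braid_1b s1_s2 s2_s3. Qed.
Lemma s2_b : s2 * sb = sb / sa * sb * s2.
Proof. exact: braid_2b s1_s3 s1_s2 s2_s3. Qed.
Lemma su_a : su * sa = sb * sa * su. Proof. exact: braid_ua s1_a s2_a s1_b. Qed.
Lemma su_b : su * sb = sb * sb * sa * su.
Proof. exact: braid_ub s1_a s1_b s2_b. Qed.
Lemma sv_a : sv * sa = sb * sv. Proof. exact: braid_va s1_a s2_a. Qed.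
Lemma sv_b : sv * sb = sb / sa * sb * sb * sv.
Proof. exact: braid_vb s1_a s2_a s1_b s2_b. Qed.

(** * The three-strand braid group inside B4 *)

Lemma psi_compat h f :
  free_lift (fun _ => s1) h * F2_lift su sv f
  = F2_lift su sv (thK h f) * free_lift (fun _ => s1) h.
Proof. by apply: K_lift_compat; [apply: braid_1u|apply: braid_1v s1_s2]. Qed.

(** The embedding of [K] onto the subgroup generated by [s1] and [s2]; by [Phi_psi] it splits the
    projection of B4 to [K]. *)
Definition psi : hom K B4 := sd_lift psi_compat.

Lemma psi_f f : psi (sd_inl thK f) = F2_lift su sv f.
Proof. exact: sd_lift_inl. Qed.
Lemma psi_u : psi ku = su. Proof. by rewrite psi_f F2_lift_u. Qed.
Lemma psi_v : psi kv = sv. Proof. by rewrite psi_f F2_lift_v. Qed.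
Lemma psi_t : psi kt = s1.
Proof. by rewrite [LHS]sd_lift_inr /= free_lift_gen. Qed.

Lemma Phi_u : Phi su = mU.
Proof.
rewrite gmulfM gmulfV Phi1 Phi2.
by apply: (mulgI mT); rewrite mulVKg mTU.
Qed.
Lemma Phi_v : Phi sv = mV.
Proof. by rewrite gmulfF Phi1 Phi2 mulgK. Qed.
Lemma Phi_a : Phi sa = mA.
Proof.
rewrite gmulfF Phi1 Phi3 invgM mulgA mulgV mul1g.
exact: mulg1_eq mA_sqr.
Qed.
Lemma Phi_b : Phi sb = mB.
Proof.
rewrite gmulfF gmulfM /= Phi_a Phi2; apply: (mulIg (mV * mT)).
by rewrite mulgVK -mulgA mTA mulgA mVA mulgA.
Qed.

Lemma Phi_psi k : Phi (psi k) = sd_inr thM k.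
Proof.
apply: (K_ind (eq_morph_is_subgroup (Phi \o psi) (sd_inr thM))) => /=.
- by rewrite psi_u Phi_u.
- by rewrite psi_v Phi_v.
- by rewrite psi_t Phi1.
Qed.

(** The braid relation says that x y conjugates x to y. *)
Lemma braid_commg (G : groupType) (x y : G) :
  x * y * x = y * x * y -> y / x = [~ (x * y)^-1, x^-1].
Proof.
by move=> xy; rewrite commgEl conjgE; cancel_group; rewrite xy; cancel_group.
Qed.

Lemma sv_D1 : derived B4 1 sv.
Proof. by rewrite [sv](braid_commg s1_s2); apply: comm_sgR. Qed.

Lemma su_D1 : derived B4 1 su.
Proof.
by have := derivedJ s1 sv_D1; rewrite conjgE mulgVK.
Qed.

Lemma sa_D1 : derived B4 1 sa.
Proof.
have -> : sa = sv^-1 * (s2 / s3) by rewrite invgF divgKA.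
apply: sgM; first exact: sgV sv_D1.
by rewrite (braid_commg (esym s2_s3)); apply: comm_sgR.
Qed.

Lemma commutator_eq (G : groupType) (x y z : G) :
  x * y = z * y * x -> z = [~ x^-1, y^-1].
Proof. by move=> xy; rewrite commgEl conjgE !invgK !mulgA xy !mulgK. Qed.

(** The relation u a u^-1 = b a exhibits b as a commutator of elements of B4^(1). *)
Lemma sb_D2 : derived B4 2 sb.
Proof.
rewrite (commutator_eq su_a).
by apply: comm_sgR; apply: sgV; [apply: su_D1|apply: sa_D1].
Qed.

Lemma sa_D2 : derived B4 2 sa.
Proof.
have -> : sa = sb ^ sv by rewrite conjgE -sv_a mulKg.
exact: derivedJ sb_D2.
Qed.

Lemma psi_D1 f : derived B4 1 (psi (sd_inl thK f)).
Proof.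
apply: (F2_ind (preim_is_subgroup (psi \o sd_inl thK) (derived B4 1))) => /=.
  by rewrite psi_u; apply: su_D1.
by rewrite psi_v; apply: sv_D1.
Qed.

Lemma psi_D2 f : Gamma2 F2 f -> derived B4 2 (psi (sd_inl thK f)).
Proof.
move: f; apply: comm_sg_sub.
  exact: (preim_is_subgroup (psi \o sd_inl thK) (derived B4 2)).
by move=> x y _ _; rewrite !gmulfR; apply: comm_sgR; apply: psi_D1.
Qed.

Lemma psi_D3 (f : subg_type (Gamma2 F2)) :
  Gamma2 (subg_type (Gamma2 F2)) f -> derived B4 3 (psi (sd_inl thK (val f))).
Proof.
move: f; apply: comm_sg_sub.
  exact: (preim_is_subgroup (psi \o sd_inl thK \o val) (derived B4 3)).
move=> x y _ _; rewrite !gmulfR.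
by apply: comm_sgR; apply: psi_D2; apply: set_mem (valP _).
Qed.

(** * The quotient B4 / B4^(3) *)

Definition Q : groupType := quotient (derived_nsg B4 3).
Definition piQ : hom B4 Q := quot_pi (derived_nsg B4 3).
Definition qa : Q := piQ sa.
Definition qb : Q := piQ sb.

Lemma piQ_commute x y :
  derived B4 2 x -> derived B4 2 y -> commute (piQ x) (piQ y).
Proof.
move=> Dx Dy; apply/commgP/eqP; rewrite -gmulfR; apply/quot_pi_eq1.
exact: comm_sgR.
Qed.

Lemma qa_qb_commute : commute qa qb.
Proof. by apply: piQ_commute; [apply: sa_D2|apply: sb_D2]. Qed.

(** The commutator of u and v lies in B4^(2), as do a and b, and B4^(2) is abelian modulo B4^(3).
    This provides the [g] of [action_sqr_eq] and [action_sqr1]. *)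
Lemma qu_qv : exists g,
  [/\ piQ su * piQ sv = g * piQ sv * piQ su, commute g qa & commute g qb].
Proof.
exists (piQ [~ su^-1, sv^-1]).
have D2 : derived B4 2 [~ su^-1, sv^-1].
  by apply: comm_sgR; apply: sgV; [apply: su_D1|apply: sv_D1].
split; last 2 first.
- exact: piQ_commute sa_D2.
- exact: piQ_commute sb_D2.
by rewrite -[in LHS]gmulfM commgCV !gmulfM mulgA.
Qed.

Lemma qu_a : piQ su * qa = qb * qa * piQ su.
Proof. by rewrite -!gmulfM su_a. Qed.
Lemma qu_b : piQ su * qb = qb * qb * qa * piQ su.
Proof. by rewrite -!gmulfM su_b. Qed.
Lemma qv_a : piQ sv * qa = qb * piQ sv.
Proof. by rewrite -!gmulfM sv_a. Qed.
Lemma qv_b : piQ sv * qb = qb / qa * qb * qb * piQ sv.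
Proof. by rewrite -gmulfF -!gmulfM sv_b. Qed.

Lemma qb_sqr : qb * qb = 1.
Proof.
have [g [guv ga gb]] := qu_qv.
exact: action_sqr1 qu_a qu_b qv_a qv_b guv ga gb qa_qb_commute.
Qed.

Lemma qa_sqr : qa * qa = 1.
Proof.
have [g [guv ga gb]] := qu_qv; rewrite -qb_sqr.
exact: action_sqr_eq qu_a qu_b qv_a qv_b guv ga gb qa_qb_commute.
Qed.

(** * The derived factor *)

Section V4Lift.
Variables (G : groupType) (x y : G).
Hypotheses (xx : x * x = 1) (yy : y * y = 1) (xy : commute x y).

Definition Z2_pow (q : G) (z : Z2) : G := if z == 1 then 1 else q.

Lemma Z2_powM q : q * q = 1 -> {morph Z2_pow q : z t / z * t}.
Proof.
by move=> qq z t; case: (Z2_cases z) (Z2_cases t) => -> [] ->;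
  rewrite /Z2_pow /= ?qq ?mulg1 ?mul1g.
Qed.

Definition V4_fun (z : V4) : G := Z2_pow x z.1 * Z2_pow y z.2.

Fact V4_funM : {morph V4_fun : z t / z * t}.
Proof.
move=> z t; rewrite /V4_fun /= !Z2_powM // -!mulgA; congr (_ * _).
rewrite !mulgA; congr (_ * _).
by rewrite /Z2_pow; case: ifP; case: ifP => //; rewrite ?mulg1 ?mul1g.
Qed.
Fact V4_fun1 : V4_fun 1 = 1. Proof. exact: mulg1. Qed.

HB.instance Definition _ :=
  isUMagmaMorphism.Build V4 G V4_fun (V4_fun1, V4_funM).
Definition V4_lift : hom V4 G := V4_fun.

Lemma V4_lift_a : V4_lift va = x. Proof. exact: mulg1. Qed.
Lemma V4_lift_b : V4_lift vb = y. Proof. exact: mul1g. Qed.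
End V4Lift.

Definition iotaV : hom V4 Q := V4_lift qa_sqr qb_sqr qa_qb_commute.

Lemma iotaV_a : iotaV va = qa. Proof. exact: V4_lift_a. Qed.
Lemma iotaV_b : iotaV vb = qb. Proof. exact: V4_lift_b. Qed.
Lemma iotaV_ab : iotaV (va * vb) = qa * qb.
Proof. by rewrite gmulfM /= iotaV_a iotaV_b. Qed.

Lemma q1_a : piQ s1 * qa = qa * piQ s1.
Proof. by rewrite -[LHS]gmulfM s1_a gmulfM. Qed.
Lemma q1_b : piQ s1 * qb = qa * qb * piQ s1.
Proof.
by rewrite -[LHS]gmulfM s1_b gmulfM gmulfF /= (mulg1_eq qa_sqr) qa_qb_commute.
Qed.

Lemma qu_b_qa : piQ su * qb = qa * piQ su.
Proof. by rewrite qu_b qb_sqr mul1g. Qed.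
Lemma qv_b_qaqb : piQ sv * qb = qa * qb * piQ sv.
Proof.
rewrite qv_b (mulg1_eq qa_sqr) -(mulgA _ qb qb) qb_sqr mulg1.
by rewrite qa_qb_commute.
Qed.

(** Since [qa] and [qb] commute and have trivial squares, conjugation by the images of [su], [sv]
    and [s1] acts on them as [rho], [rho^-1] and [swap]. *)
Lemma Psi_compat k w :
  (piQ \o psi) k * iotaV w = iotaV (thM k w) * (piQ \o psi) k.
Proof.
move: k w; apply: K_ind; first exact: sd_compat_is_subgroup.
- apply: V4_ind; first exact: sd_compat_right_is_subgroup.
    rewrite thM_u (_ : rho va = va * vb); last by V4_dec.
    by rewrite /= psi_u iotaV_a iotaV_ab qa_qb_commute qu_a.
  rewrite thM_u (_ : rho vb = va); last by V4_dec.
  by rewrite /= psi_u iotaV_a iotaV_b qu_b_qa.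
- apply: V4_ind; first exact: sd_compat_right_is_subgroup.
    rewrite thM_v (_ : rho^-1 va = vb); last by V4_dec.
    by rewrite /= psi_v iotaV_a iotaV_b qv_a.
  rewrite thM_v (_ : rho^-1 vb = va * vb); last by V4_dec.
  by rewrite /= psi_v iotaV_b iotaV_ab qv_b_qaqb.
- apply: V4_ind; first exact: sd_compat_right_is_subgroup.
    rewrite thM_t (_ : swap va = va); last by V4_dec.
    by rewrite /= psi_t iotaV_a q1_a.
  rewrite thM_t (_ : swap vb = va * vb); last by V4_dec.
  by rewrite /= psi_t iotaV_b iotaV_ab q1_b.
Qed.

Definition Psi : hom M Q := sd_lift Psi_compat.

Lemma Psi_inl w : Psi (sd_inl thM w) = iotaV w.
Proof. exact: sd_lift_inl. Qed.
Lemma Psi_inr k : Psi (sd_inr thM k) = piQ (psi k).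
Proof. exact: sd_lift_inr. Qed.

Lemma Psi_Phi x : Psi (Phi x) = piQ x.
Proof.
apply: (B4_ind (eq_morph_is_subgroup (Psi \o Phi) piQ)) => /=.
- by rewrite Phi1 Psi_inr psi_t.
- by rewrite Phi2 gmulfM /= !Psi_inr psi_v psi_t -gmulfM mulgVK.
(* Here s3 = a^-1 s1, and [qa] is its own inverse. *)
- rewrite Phi3 gmulfM /= Psi_inl Psi_inr psi_t iotaV_a.
  rewrite -(mulg1_eq qa_sqr) -gmulfV -gmulfM; congr (piQ _).
  by rewrite invgF mulgVK.
Qed.

(** * Images of the derived subgroups under Phi *)

Lemma F2_morph_commute (G : groupType) (f : hom F2 G) :
  commute (f fu) (f fv) -> forall x y, commute (f x) (f y).
Proof.
move=> cuv; apply: (@morph_commute _ _ f (fun x => x = fu \/ x = fv)).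
  by move=> P sgP PA; apply: F2_ind => //; apply: PA; [left|right].
by move=> _ _ [->|->] [->|->] //; apply: commute_sym.
Qed.

(** On [F2] the action takes its values in the powers of [rho], which commute. *)
Lemma thM_Gamma2 f : Gamma2 F2 f -> thM (sd_inl thK f) = 1.
Proof.
rewrite thM_f => Gf; apply: comm_sg_morph_eq1 Gf => x y _ _.
by apply: F2_morph_commute; rewrite /= F2_lift_u F2_lift_v; apply: commuteV.
Qed.

(** The exponent sum of a braid: every Artin generator is sent to [zt]. *)
Definition degree : hom B4 Zgrp :=
  sd_snd (th := thK) \o sd_snd (th := thM) \o Phi.

Lemma Phi_D1 x : derived B4 1 x -> degree x = 1.
Proof.
apply: (@comm_sg_morph_eq1 _ _ _ (setT_sg B4) (setT_sg B4)) => {x} y z _ _.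
apply: (@morph_commute _ _ degree (fun x => [\/ x = s1, x = s2 | x = s3])) y z.
  move=> P sgP PA; apply: B4_ind => //; apply: PA;
    by [constructor 1|constructor 2|constructor 3].
have E y : [\/ y = s1, y = s2 | y = s3] -> degree y = zt.
  by case=> ->; rewrite /= ?Phi1 ?Phi2 ?Phi3 //; exact: mul1g.
by move=> y z /E -> /E ->.
Qed.

(** The degree vanishes on B4^(1), so the component in [K] lies in the free factor there;
    commutators of such elements fall into [Gamma2 F2]. *)
Lemma Phi_D2 x : derived B4 2 x ->
  exists2 f, Gamma2 F2 f & sd_snd (Phi x) = sd_inl thK f.
Proof.
have D1 y : derived B4 1 y -> exists f, sd_snd (Phi y) = sd_inl thK f.
  move=> /Phi_D1 d1; exists (sd_snd (Phi y)).1.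
  by rewrite [LHS]sd_split (d1 : (sd_snd (Phi y)).2 = 1) gmulf1 mulg1.
move: x; apply: (@comm_sg_sub _ _ _
  (fun x => exists2 f, Gamma2 F2 f & sd_snd (Phi x) = sd_inl thK f)).
  split=> [|y z [f Gf Ef] [g Gg Eg]].
    by exists 1; [apply: sg1|rewrite !gmulf1].
  by exists (f / g); [apply: sgF|rewrite !gmulfF /= Ef Eg].
move=> y z /D1 [f Ef] /D1 [g Eg]; exists [~ f, g]; first exact: comm_sgR.
by rewrite !gmulfR /= Ef Eg.
Qed.

Lemma abelianization_commute (G : groupType) (x y : abelianization G) :
  commute x y.
Proof.
have [[{}x ->] [{}y ->]] := (quot_piP x, quot_piP y).
apply/commgP/eqP; rewrite -gmulfR; apply/quot_pi_eq1.
exact: (comm_sgR (H := setT_sg G) (K := setT_sg G)).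
Qed.

(** The commutators generating G^(n+1) are taken in [G], whereas [f] lives on G^(n). The induction
    therefore runs over elements of [G] that have a lift to G^(n) killed by [f]. *)
Lemma derived_next_eq1 (G H : groupType) n
    (f : hom (subg_type (derived G n)) H) :
  (forall x y, commute (f x) (f y)) -> forall x, derived_next G n x -> f x = 1.
Proof.
move=> cf x Dx; pose D := subg_type (derived G n).
have [y /val_inj -> //] : exists2 y : D, val x = val y & f y = 1.
move: Dx; rewrite -[derived_next G n x]/(derived G n.+1 (val x)); move: (val x).
apply: (@comm_sg_sub _ _ _ (fun z => exists2 y : D, z = val y & f y = 1)).
  split=> [|_ _ [y -> fy] [z -> fz]]; first by exists 1; rewrite ?gmulf1.
  by exists (y / z); rewrite ?gmulfF ?fy ?fz ?divg1.
move=> y z Dy Dz.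
pose y' : D := Sub y (mem_set Dy); pose z' : D := Sub z (mem_set Dz).
exists [~ y', z']; first by rewrite gmulfR.
by rewrite gmulfR; apply/eqP/commgP.
Qed.

(** * The coordinate map on B4^(2) *)

Local Notation D2 := (subg_type (derived B4 2)).
Local Notation Gam := (subg_type (Gamma2 F2)).

Lemma val_D2 (x : D2) : derived B4 2 (val x).
Proof. exact: set_mem (valP x). Qed.

Definition F2_coord (x : D2) : F2 := (sd_snd (Phi (val x))).1.

Lemma F2_coordP x : Gamma2 F2 (F2_coord x).
Proof. by have [f Gf Ef] := Phi_D2 (val_D2 x); rewrite /F2_coord Ef. Qed.

Lemma Phi_D2_split x :
  Phi (val x)
  = sd_inl thM (Phi (val x)).1 * sd_inr thM (sd_inl thK (F2_coord x)).
Proof.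
have [f Gf Ef] := Phi_D2 (val_D2 x).
by rewrite /F2_coord Ef /= -Ef -sd_split.
Qed.

Lemma Phi_snd x : sd_snd (Phi (val x)) = sd_inl thK (F2_coord x).
Proof. by rewrite {1}Phi_D2_split gmulfM /= mul1g. Qed.

Definition Gamma2_coord (x : D2) : Gam :=
  Sub (F2_coord x) (mem_set (F2_coordP x)).

Definition coord (x : D2) : (Z2 * Z2 * abelianization Gam)%type :=
  ((Phi (val x)).1, quot_pi _ (Gamma2_coord x)).

Fact coordM : {morph coord : x y / x * y}.
Proof.
move=> x y; have PM : Phi (val (x * y)) = Phi (val x) * Phi (val y).
  by rewrite !gmulfM.
have Gamma2_coordM : Gamma2_coord (x * y) = Gamma2_coord x * Gamma2_coord y.
  have /(congr1 fst) : sd_inl thK (F2_coord (x * y))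
                       = sd_inl thK (F2_coord x * F2_coord y).
    by rewrite [RHS]gmulfM -Phi_snd PM gmulfM /= !Phi_snd.
  by move=> /= gE; apply: val_inj; rewrite gmulfM.
congr (_, _); last by rewrite /= Gamma2_coordM gmulfM.
rewrite /= PM; transitivity
  ((Phi (val x)).1 * thM (sd_snd (Phi (val x))) (Phi (val y)).1) => //.
(* The twist by the action vanishes, since [Gamma2 F2] acts trivially on [V4]. *)
by rewrite Phi_snd thM_Gamma2 //; apply: F2_coordP.
Qed.

Fact coord1 : coord 1 = 1.
Proof. by apply: (mulgI (coord 1)); rewrite -coordM !mulg1. Qed.

HB.instance Definition _ := isUMagmaMorphism.Build D2 _ coord (coord1, coordM).

Lemma coord_commute x y : commute (coord x) (coord y).
Proof. by congr (_, _); [apply: V4_commute|apply: abelianization_commute]. Qed.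

Lemma coord_ker x : derived_next B4 2 x <-> coord x = 1.
Proof.
split; first exact: (derived_next_eq1 coord_commute).
move=> c1; have v1 : (Phi (val x)).1 = 1 := congr1 fst c1.
have g1 : Gamma2 Gam (Gamma2_coord x).
  exact: (quot_pi_eq1 (Gamma2_nsg Gam) _).1 (congr1 snd c1).
(* Only the free coordinate of [Phi (val x)] is left. [Psi] sends it to the class of its image under
   [psi], which lies in B4^(3) by [psi_D3]. *)
apply/(quot_pi_eq1 (derived_nsg B4 3)); rewrite -[LHS]Psi_Phi.
rewrite Phi_D2_split v1 gmulf1 mul1g Psi_inr.
by apply/quot_pi_eq1; apply: (psi_D3 g1).
Qed.

Lemma Phi_V4_surj w : exists2 x, derived B4 2 x & Phi x = sd_inl thM w.
Proof.
move: w; apply: V4_ind.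
- split=> [|w t [x Dx Px] [y Dy Py]].
    by exists 1; rewrite ?gmulf1 //; apply: sg1.
  by exists (x / y); [apply: sgF|rewrite !gmulfF Px Py].
- by exists sa; [apply: sa_D2|apply: Phi_a].
- by exists sb; [apply: sb_D2|apply: Phi_b].
Qed.

Lemma coord_surj y : exists x, coord x = y.
Proof.
case: y => w g; have [{}g ->] := quot_piP g.
have [x Dx Px] := Phi_V4_surj w.
(* The first factor has [V4] coordinate [w] and trivial free coordinate; the second supplies the
   free coordinate, as [psi] is a splitting. *)
pose z := x * psi (sd_inl thK (val g)).
have Dz : derived B4 2 z.
  by apply: sgM => //; apply: psi_D2; apply: set_mem (valP g).
have Pz : Phi z = (w, sd_inl thK (val g)).
  by rewrite gmulfM /= Px Phi_psi [RHS]sd_split.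
exists (Sub z (mem_set Dz)); congr (_, _); first by rewrite /= Pz.
by congr (quot_pi _ _); apply: val_inj; rewrite /= /F2_coord Pz.
Qed.

Theorem proposition6 :
  isomorphic (derived_factor B4 2)
             (Z2 * Z2 * abelianization (subg_type (Gamma2 F2)))%type.
Proof. exact: isomorphic_quotient coord_ker coord_surj. Qed.
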